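(* Let $\mathbf e=(e_1,\dots,e_m)\in\mathbb Z^m$ with $\gcd(e_1,\dots,e_m,r)=1$, and let $c$ be an integer with $1\le c\le q-2$. Then the dimension $k$ (over $\mathbb F_{q^r}$) and the minimum sum-rank distance $d$ of the linearized Reed--Muller code $\mathrm{LRM}(\mathbf e;c)$ satisfy $$k=\binom{c+m}{c}\qquad\text{and}\qquad d\ \ge\ r\,(q-1)^{m-1}\,(q-1-c).$$
   Context: $\mathbb F_q$ is a finite field with $q$ elements, $\mathbb F_{q^r}$ its extension of degree $r\ge 1$, $\Phi:\mathbb F_{q^r}\to\mathbb F_{q^r}$, $x\mapsto x^q$, and $m\ge1$. The ring $\mathbb F_{q^r}[\mathbf X^{\pm1};\boldsymbol\theta]$ of multivariate Ore Laurent polynomials consists of finite sums $\sum_{\mathbf u\in\mathbb Z^m}a_{\mathbf u}\mathbf X^{\mathbf u}$ ($a_{\mathbf u}\in\mathbb F_{q^r}$, $\mathbf X^{\mathbf u}=X_1^{u_1}\cdots X_m^{u_m}$), where the variables commute with each other and $\mathbf X^{\mathbf u}\cdot a=\Phi^{\mathbf e\cdot\mathbf u}(a)\,\mathbf X^{\mathbf u}$ for $a\in\mathbb F_{q^r}$, with $\mathbf e\cdot\mathbf u=\sum_i e_iu_i$. The subring $\mathbb F_{q^r}[\mathbf X;\boldsymbol\theta]$ consists of the elements involving only nonnegative exponents. Let $L=\{\mathbf u\in\mathbb Z^m:\mathbf e\cdot\mathbf u\in r\mathbb Z\}$ and let $H$ be the set of group homomorphisms $\gamma:L\to\mathbb F_q^\times$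 (it has cardinality $(q-1)^m$). For every $\gamma\in H$ fix a function $\tilde\gamma:\mathbb Z^m\to\mathbb F_{q^r}^\times$ extending $\gamma$ and satisfying the cocycle condition $\tilde\gamma(\mathbf u+\mathbf v)=\tilde\gamma(\mathbf u)\cdot\Phi^{\mathbf e\cdot\mathbf u}(\tilde\gamma(\mathbf v))$ for all $\mathbf u,\mathbf v\in\mathbb Z^m$ (such extensions exist). This gives a ring homomorphism $\epsilon_{\tilde\gamma}:\mathbb F_{q^r}[\mathbf X^{\pm1};\boldsymbol\theta]\to\operatorname{End}_{\mathbb F_q}(\mathbb F_{q^r})$, $\sum a_{\mathbf u}\mathbf X^{\mathbf u}\mapsto\sum a_{\mathbf u}\tilde\gamma(\mathbf u)\Phi^{\mathbf e\cdot\mathbf u}$. Put $\epsilon=(\epsilon_{\tilde\gamma})_{\gamma\in H}$, with values in $\mathcal H=\prod_{\gamma\in H}\operatorname{End}_{\mathbb F_q}(\mathbb F_{q^r})$; $\mathcal H$ is an $\mathbb F_{q^r}$-vector space via $(a\varphi)(x)=a\cdot\varphi(x)$. $\mathrm{LRM}(\mathbf e;c)=\epsilon\big(\mathbb F_{q^r}[\mathbf X;\boldsymbol\theta]_{\le c}\big)$, where $\mathbb F_{q^r}[\mathbf X;\boldsymbol\theta]_{\le c}$ is the $\mathbb F_{q^r}$-span of the monomials $\mathbf X^{\mathbf u}$ with $u_i\ge0$ for all $i$ and $u_1+\cdots+u_m\le c$. The sum-rank weight of $(\varphi_\gamma)_{\gamma\in H}\in\mathcal H$ is $\sum_\gamma\operatorname{rank}_{\mathbb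 F_q}(\varphi_\gamma)$, and the minimum distance of a code is the minimum sum-rank weight of its nonzero elements. *)

(* Defs.v *)
From HB Require Import structures.
From mathcomp Require Import all_boot all_order all_fingroup all_algebra.
From mathcomp Require Import all_solvable all_field.
From mathcomp Require Import finmap monalg.
From mathcomp Require Import boolp.

Set Implicit Arguments.
Unset Strict Implicit.
Unset Printing Implicit Defensive.

Import GRing.Theory Num.Theory.
Import FalgLfun.

Local Open Scope ring_scope.

Section Frobenius.
Context {F : finFieldType}.
Variable K : fieldExtType F.

Definition powq (x : K) : K := x ^+ #|F|.

Lemma powqD : {morph powq : x y / x + y}.
Proof.
move=> x y; have [p p_pr pcF] := finPcharP F.
apply: exprDn_pchar; rewrite (eq_pnat _ (pchar_lalg K)) (eq_pnat _ (pcharf_eq pcF)).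
by have := pprimeChar_pgroup pcF; rewrite /pgroup.pgroup cardsT.
Qed.

Lemma powq_semilinear : semilinear powq.
Proof.
split=> [a x|x y]; last exact: powqD.
by rewrite /powq exprZn expf_card.
Qed.

HB.instance Definition _ :=
  GRing.isSemilinear.Build F K K *:%R powq powq_semilinear.

(* The q-Frobenius of K as an element of the unit ring 'End(K), so that
   [Frob ^ n] makes sense for every [n : int]. *)
Definition Frob : 'End(K) := linfun powq.

Lemma FrobE x : Frob x = x ^+ #|F|.
Proof. by rewrite /Frob lfunE. Qed.

Lemma FrobM x y : Frob (x * y) = Frob x * Frob y.
Proof. by rewrite !FrobE exprMn. Qed.

Lemma Frob_lker0 : lker Frob == 0%VS.
Proof.
apply/eqP; apply/vspaceP=> x; rewrite memv_ker FrobE memv0 expf_eq0.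
by rewrite (ltnW (finNzRing_gt1 F)).
Qed.

Lemma Frob_unit : Frob \is a GRing.unit.
Proof.
by apply/unitrP; exists Frob^-1%VF; rewrite lfun_mulVr ?lfun_mulrV ?Frob_lker0.
Qed.

Lemma FrobzD (n p : int) x : (Frob ^ (n + p)) x = (Frob ^ n) ((Frob ^ p) x).
Proof. by rewrite addrC exprzDr ?Frob_unit // lfun_mulE. Qed.

Lemma FrobzM (n : int) x y :
  (Frob ^ n) (x * y) = (Frob ^ n) x * (Frob ^ n) y.
Proof.
have H k (u v : K) : (Frob ^+ k) (u * v) = (Frob ^+ k) u * (Frob ^+ k) v.
  elim: k u v => [|k IH] u v; first by rewrite expr0 !id_lfunE.
  by rewrite exprS !lfun_mulE FrobM IH.
case: n => k; first exact: H.
have U : Frob ^+ k.+1 \is a GRing.unit by rewrite unitrX // Frob_unit.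
have E u : (Frob ^+ k.+1) ((Frob ^- k.+1) u) = u.
  by rewrite -lfun_mulE mulVr // id_lfunE.
have E' u : (Frob ^- k.+1) ((Frob ^+ k.+1) u) = u.
  by rewrite -lfun_mulE mulrV // id_lfunE.
rewrite [Frob ^ _]/(Frob ^- k.+1) -{1}[x]E -{1}[y]E -H E'.
by [].
Qed.

End Frobenius.

Section Lattice.
Variable m : nat.
Implicit Types e u v : 'rV[int]_m.

Definition dotz e u : int := \sum_i e 0 i * u 0 i.

Lemma dotzD e : {morph dotz e : u v / u + v}.
Proof.
by move=> u v; rewrite -big_split; apply: eq_bigr => i _; rewrite mxE mulrDr.
Qed.

Lemma dotzB e : {morph dotz e : u v / u - v}.
Proof.
by move=> u v; rewrite -sumrB; apply: eq_bigr => i _; rewrite !mxE mulrBr.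
Qed.

Lemma dotz0 e : dotz e 0 = 0.
Proof. by apply: big1 => i _; rewrite mxE mulr0. Qed.

Context {F : finFieldType}.
Variable K : fieldExtType F.

(* The degree r of the extension K / F is \dim {:K}. *)
Definition in_lattice e : {pred 'rV[int]_m} :=
  fun u => ((\dim {:K})%:Z %| dotz e u)%Z.

Lemma in_lattice_zmod e : zmod_closed (in_lattice e).
Proof.
have E u : (u \in in_lattice e) = ((\dim {:K})%:Z %| dotz e u)%Z by [].
split=> [|u v]; rewrite !E ?dotz0 ?dvdz0 // dotzB; exact: rpredB.
Qed.

HB.instance Definition _ e :=
  GRing.isZmodClosed.Build _ (in_lattice e) (in_lattice_zmod e).

Definition lattice e := {u : 'rV[int]_m | in_lattice e u}.

HB.instance Definition _ e := SubChoice.on (lattice e).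
HB.instance Definition _ e := [SubChoice_isSubZmodule of lattice e by <:].

(* Multiplicative characters of the additive group L; finitely many, see the
   Finite instance below. *)
Record latHom e := LatHom {
  latHom_fun :> lattice e -> {unit F};
  latHomD : forall u v : lattice e, latHom_fun (u + v) = (latHom_fun u * latHom_fun v)%g }.


Section LatHomFinite.
Context {e : 'rV[int]_m}.
Let lH := latHom e.

Lemma latHom_inj (g h : lH) : (forall u : lattice e, g u = h u) -> g = h.
Proof.
case: g h => [g gD] [h hD] /= /funext E; case: _ / E in hD *.
by rewrite (Prop_irrelevance gD hD).
Qed.

Lemma latHom0 (g : lH) : g 0 = 1%g.
Proof. by apply: (mulgI (g 0)); rewrite -latHomD addr0 mulg1. Qed.

Lemma latHomMn (g : lH) (u : lattice e) n : g (u *+ n) = (g u ^+ n)%g.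
Proof. by elim: n => [|n IH]; rewrite ?latHom0 // mulrS latHomD IH expgS. Qed.

Let per := (#|[set: {unit F}]| * \dim {:K})%N.

Let per_gt0 : (0 < per)%N.
Proof. by rewrite muln_gt0 cardG_gt0 adim_gt0. Qed.

Let per_neq0 : per%:Z != 0.
Proof. by rewrite eqz_nat -lt0n. Qed.

Let box := {ffun 'I_m -> 'I_per}.

Let boxv (w : box) : 'rV[int]_m := \row_i (w i : nat)%:Z.

Let code (g : lH) : {ffun box -> {unit F}} :=
  [ffun w => if insub (boxv w) is Some u then g u else 1%g].

Let code_inj : injective code.
Proof.
move=> g h gh; apply: latHom_inj => u.
pose q : 'rV[int]_m := \row_i ((\dim {:K})%:Z * (val u ord0 i %/ per)%Z).
have qL : in_lattice e q.
  rewrite /in_lattice /dotz; apply: rpred_sum => i _.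
  by rewrite mxE mulrCA dvdz_mulr.
have mP i : (`|(val u ord0 i %% per)%Z|%N < per)%N.
  by rewrite -ltz_nat gez0_abs ?modz_ge0 ?ltz_pmod.
pose w : box := [ffun i => Ordinal (mP i)].
have uE : val u = q *+ #|[set: {unit F}]| + boxv w.
  apply/rowP=> i; rewrite !mxE mulmxnE !mxE ffunE /=.
  rewrite gez0_abs ?modz_ge0 // {1}[val u ord0 i](divz_eq _ per).
  by congr (_ + _); rewrite -[RHS]mulr_natl natz mulrA -PoszM mulrC.
have wL : in_lattice e (boxv w).
  have -> : boxv w = val u - q *+ #|[set: {unit F}]| by rewrite uE addrC addKr.
  apply: (@rpredB _ (in_lattice e)); first exact: (valP u).
  exact: (@rpredMn _ (in_lattice e)).
have {uE} -> : u = (Sub q qL : lattice e) *+ #|[set: {unit F}]| + Sub (boxv w) wL.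
  by apply: val_inj; rewrite raddfD raddfMn.
rewrite !latHomD !latHomMn !expg_cardG ?inE // !mul1g.
by have /ffunP/(_ w) := gh; rewrite !ffunE insubT.
Qed.

Let decode (f : {ffun box -> {unit F}}) : option lH :=
  if pselect (exists g, code g = f) is left ex then Some (sval (cid ex))
  else None.

Let codeK : pcancel code decode.
Proof.
move=> g; rewrite /decode; case: pselect => [ex|[]]; last by exists g.
by congr Some; apply: code_inj; case: cid.
Qed.

HB.instance Definition _ := Finite.copy (latHom e) (pcan_type codeK).

End LatHomFinite.

End Lattice.

Arguments in_lattice {m F} K e.
Arguments lattice {m F} K e.
Arguments latHom {m F} K e.

Section EndL.
Context {F : finFieldType}.
Variable K : fieldExtType F.

(* End_{F_q}(K) with its structure of vector space over K, not over F. *)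
Definition endL := 'End(K).

HB.instance Definition _ := GRing.Zmodule.copy endL 'End(K).

Definition endL_scale (a : K) (phi : endL) : endL := (amull a \o phi)%VF.

Lemma endL_scaleE a phi x : (endL_scale a phi : 'End(K)) x = a * (phi : 'End(K)) x.
Proof. by rewrite comp_lfunE lfunE. Qed.

Fact endL_scaleA a b phi :
  endL_scale a (endL_scale b phi) = endL_scale (a * b) phi.
Proof. by apply/lfunP=> x; rewrite !endL_scaleE mulrA. Qed.

Fact endL_scale1 : left_id 1 endL_scale.
Proof. by move=> phi; apply/lfunP=> x; rewrite endL_scaleE mul1r. Qed.

Fact endL_scaleDr : right_distributive endL_scale +%R.
Proof.
move=> a phi psi; apply/lfunP=> x.
by rewrite endL_scaleE !add_lfunE !endL_scaleE mulrDr.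
Qed.

Fact endL_scaleDl phi : {morph endL_scale^~ phi : a b / a + b}.
Proof.
move=> a b; apply/lfunP=> x.
by rewrite endL_scaleE !add_lfunE !endL_scaleE mulrDl.
Qed.

HB.instance Definition _ := GRing.Zmodule_isLmodule.Build K endL
  endL_scaleA endL_scale1 endL_scaleDr endL_scaleDl.

Let b := vbasis {:K}.

Let comb (w : 'rV[K]_(\dim {:K})) (x : K) : K :=
  \sum_i coord b i x *: w 0 i.

Let comb_semilinear w : semilinear (comb w).
Proof.
split=> [a x|x y].
  by rewrite scaler_sumr; apply: eq_bigr => i _; rewrite linearZ scalerA.
by rewrite -big_split; apply: eq_bigr => i _; rewrite linearD scalerDl.
Qed.

HB.instance Definition _ w :=
  GRing.isSemilinear.Build F K K *:%R (comb w) (comb_semilinear w).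

Fact endL_vect_axiom : Vector.axiom (\dim {:K}) endL.
Proof.
exists (fun phi : endL => \row_i (phi : 'End(K)) b`_i).
  by move=> a phi psi; apply/rowP=> i; rewrite !mxE add_lfunE endL_scaleE.
have bb := vbasisP {:K}; have fb := basis_free bb.
exists (fun w => linfun (comb w) : endL) => [phi|w].
  apply/lfunP=> x; rewrite lfunE /= /comb.
  rewrite [in RHS](coord_basis bb (memvf x)) linear_sum.
  by apply: eq_bigr => i _; rewrite mxE linearZ.
apply/rowP=> j; rewrite mxE lfunE /= /comb (bigD1 j) //= big1 ?addr0.
  by rewrite coord_free // eqxx scale1r.
by move=> i ij; rewrite coord_free // eq_sym (negPf ij) scale0r.
Qed.

HB.instance Definition _ := Lmodule_hasFinDim.Build K endL endL_vect_axiom.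

End EndL.

Lemma submod_vspace (k : fieldType) (V : vectType k) (P : V -> Prop) :
    P 0 -> (forall a u v, P u -> P v -> P (a *: u + v)) ->
  {U : {vspace V} | forall w, w \in U <-> P w}.
Proof.
move=> P0 PZD; apply: cid.
pose Q n := `[< exists2 U : {vspace V}, \dim U = n & forall w, w \in U -> P w >].
have exQ : exists n, Q n.
  exists 0%N; apply/asboolP; exists 0%VS; first exact: dimv0.
  by move=> w; rewrite memv0 => /eqP->.
have bQ n : Q n -> (n <= \dim {:V})%N.
  by move=> /asboolP[U <- _]; rewrite dimvS ?subvf.
case: (ex_maxnP exQ bQ) => n /asboolP[U dU UP] maxU.
exists U => w; split=> [/UP //|Pw].
have : Q (\dim (U + <[w]>)).
  apply/asboolP; exists (U + <[w]>)%VS => // _ /memv_addP[u /UP Pu [_ /vlineP[a ->] ->]].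
  by rewrite addrC; apply: PZD.
move/maxU; rewrite -dU => le.
have /eqP-> : U == (U + <[w]>)%VS by rewrite eqEdim addvSl.
by rewrite (subvP (addvSr _ _)) ?memv_line.
Qed.

Section OreLaurent.
Context {F : finFieldType}.
Variables (K : fieldExtType F) (m : nat) (e : 'rV[int]_m).

(* Finite sums \sum_u a_u X^u, i.e. finitely supported coefficient families;
   [f@_u] is the coefficient a_u and [<< a *g u >>] the term a X^u. The
   multiplication below makes this the Ore ring K[X^{+-1}; theta]. *)
Definition oreLaurent := {malg K['rV[int]_m]}.

HB.instance Definition _ := GRing.Lmodule.copy oreLaurent {malg K['rV[int]_m]}.

Implicit Types f g h : oreLaurent.

Definition ore_term (a : K) (u : 'rV[int]_m) : oreLaurent := << a *g u >>.

Definition theta (u : 'rV[int]_m) : 'End(K) := Frob K ^ dotz e u.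

Lemma thetaD u v x : theta (u + v) x = theta u (theta v x).
Proof. by rewrite /theta dotzD FrobzD. Qed.

Lemma thetaM u x y : theta u (x * y) = theta u x * theta u y.
Proof. exact: FrobzM. Qed.

Lemma theta0 x : theta 0 x = x.
Proof. by rewrite /theta dotz0 expr0z id_lfunE. Qed.

Lemma theta1 u : theta u 1 = 1.
Proof.
have t1 : theta u 1 != 0.
  apply/eqP => t10; have := theta0 1.
  rewrite -(addNr u) thetaD t10 linear0 => /esym/eqP.
  by rewrite oner_eq0.
by apply: (mulfI t1); rewrite -thetaM !mulr1.
Qed.

Definition ore_mul f g : oreLaurent :=
  \sum_(u <- msupp f) \sum_(v <- msupp g)
     ore_term (f@_u * theta u g@_v) (u + v).

Lemma ore_termD a b u : ore_term (a + b) u = ore_term a u + ore_term b u.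
Proof. exact: monalgUD. Qed.

Lemma ore_term0 u : ore_term 0 u = 0.
Proof. exact: monalgU0. Qed.

Lemma ore_mulw (d1 d2 : {fset 'rV[int]_m}) f g :
  (msupp f `<=` d1)%fset -> (msupp g `<=` d2)%fset ->
  ore_mul f g = \sum_(u <- d1) \sum_(v <- d2)
     ore_term (f@_u * theta u g@_v) (u + v).
Proof.
move=> le_d1 le_d2; rewrite /ore_mul (big_fset_incl _ le_d1) /=.
  apply/eq_bigr=> u _; apply/big_fset_incl => // v _ /mcoeff_outdom ->.
  by rewrite linear0 mulr0 ore_term0.
move=> u _ /mcoeff_outdom fu.
by rewrite big1 // => v _; rewrite fu mul0r ore_term0.
Qed.

Lemma ore_mulDl : left_distributive ore_mul +%R.
Proof.
move=> f g h.
have le1 := fsubsetUl (msupp f) (msupp g).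
have le2 := fsubsetUr (msupp f) (msupp g).
rewrite (ore_mulw le1 (fsubset_refl _)) (ore_mulw le2 (fsubset_refl _)).
rewrite (ore_mulw (msuppD_le f g) (fsubset_refl _)).
rewrite -big_split /=; apply: eq_bigr => u _.
rewrite -big_split /=; apply: eq_bigr => v _.
by rewrite mcoeffD mulrDl ore_termD.
Qed.

Lemma ore_mulDr : right_distributive ore_mul +%R.
Proof.
move=> h f g.
have le1 := fsubsetUl (msupp f) (msupp g).
have le2 := fsubsetUr (msupp f) (msupp g).
rewrite (ore_mulw (fsubset_refl _) le1) (ore_mulw (fsubset_refl _) le2).
rewrite (ore_mulw (fsubset_refl _) (msuppD_le f g)).
rewrite -big_split /=; apply: eq_bigr => u _.
rewrite -big_split /=; apply: eq_bigr => v _.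
by rewrite mcoeffD linearD mulrDr ore_termD.
Qed.

Lemma ore_mul0l f : ore_mul 0 f = 0.
Proof. by rewrite /ore_mul msupp0 big_seq_fset0. Qed.

Lemma ore_mul0r f : ore_mul f 0 = 0.
Proof. by rewrite /ore_mul big1 // => u _; rewrite msupp0 big_seq_fset0. Qed.

Lemma ore_mulT a u b v :
  ore_mul (ore_term a u) (ore_term b v) = ore_term (a * theta u b) (u + v).
Proof.
by rewrite (ore_mulw msuppU_le msuppU_le) !big_seq_fset1 !mcoeffUU.
Qed.

Lemma oreE f : f = \sum_(u <- msupp f) ore_term f@_u u.
Proof. exact: monalgE. Qed.

Lemma ore_mul_suml (I : Type) (r : seq I) (G : I -> oreLaurent) g :
  ore_mul (\sum_(i <- r) G i) g = \sum_(i <- r) ore_mul (G i) g.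
Proof.
exact: (big_morph (ore_mul^~ g) (fun f h => ore_mulDl f h g) (ore_mul0l g)).
Qed.

Lemma ore_mul_sumr (I : Type) (r : seq I) (G : I -> oreLaurent) g :
  ore_mul g (\sum_(i <- r) G i) = \sum_(i <- r) ore_mul g (G i).
Proof. exact: (big_morph (ore_mul g) (ore_mulDr g) (ore_mul0r g)). Qed.

Lemma ore_mulA : associative ore_mul.
Proof.
move=> f g h; rewrite (oreE f) !ore_mul_suml; apply: eq_bigr => u _.
rewrite (oreE g) ore_mul_suml !ore_mul_sumr ore_mul_suml; apply: eq_bigr => v _.
rewrite (oreE h) !ore_mul_sumr; apply: eq_bigr => w _.
by rewrite !ore_mulT thetaM -thetaD !mulrA addrA.
Qed.

Lemma ore_mul1l : left_id (ore_term 1 0) ore_mul.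
Proof.
move=> f; rewrite [in LHS](oreE f) ore_mul_sumr [RHS]oreE.
by apply: eq_bigr => u _; rewrite ore_mulT theta0 mul1r add0r.
Qed.

Lemma ore_mul1r : right_id (ore_term 1 0) ore_mul.
Proof.
move=> f; rewrite [in LHS](oreE f) ore_mul_suml [RHS]oreE.
by apply: eq_bigr => u _; rewrite ore_mulT theta1 mulr1 addr0.
Qed.

Lemma ore1_neq0 : ore_term 1 0 != 0.
Proof. by rewrite monalgU_eq0 oner_eq0. Qed.

HB.instance Definition _ := GRing.Zmodule_isNzRing.Build oreLaurent
  ore_mulA ore_mul1l ore_mul1r ore_mulDl ore_mulDr ore1_neq0.

Lemma ore_commute (u : 'rV[int]_m) (a : K) :
  ore_term 1 u * ore_term a 0 = ore_term (theta u a) 0 * ore_term 1 u.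
Proof.
by rewrite -!/(ore_mul _ _) [LHS]ore_mulT [RHS]ore_mulT theta1 mul1r mulr1 addrC.
Qed.

(* K[X; theta]_{<= c}: the K-span of the X^u with u >= 0 and |u| <= c. *)
Definition ore_le (c : nat) f : Prop :=
  forall u, u \in msupp f -> (forall i, 0 <= u 0 i) /\ \sum_i u 0 i <= c%:Z.

(* The data fixed for each gamma: a K^x-valued extension of gamma to Z^m
   satisfying the cocycle condition. *)
Record cocycle_ext (gamma : latHom K e) := CocycleExt {
  cocycle_fun :> 'rV[int]_m -> K;
  cocycle_neq0 : forall u, cocycle_fun u != 0;
  cocycle_extends : forall u : lattice K e,
    cocycle_fun (val u) = (val (gamma u))%:A;
  cocycleD : forall u v,
    cocycle_fun (u + v) = cocycle_fun u * theta u (cocycle_fun v) }.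

Section Eval.
Variable t : 'rV[int]_m -> K.

Definition eps_at f : endL K :=
  \sum_(u <- msupp f) (f@_u * t u) *: (theta u : endL K).

Lemma eps_atw (d : {fset 'rV[int]_m}) f : (msupp f `<=` d)%fset ->
  eps_at f = \sum_(u <- d) (f@_u * t u) *: (theta u : endL K).
Proof.
move=> le; apply: big_fset_incl => // u _ /mcoeff_outdom->.
by rewrite mul0r scale0r.
Qed.

Lemma eps_at_semilinear : semilinear eps_at.
Proof.
split=> [a f|f g].
  rewrite (eps_atw (msuppZ_le a f)) scaler_sumr.
  by apply: eq_bigr => u _; rewrite scalerA mcoeffZ mulrA.
have le1 := fsubsetUl (msupp f) (msupp g).
have le2 := fsubsetUr (msupp f) (msupp g).
rewrite (eps_atw le1) (eps_atw le2) (eps_atw (msuppD_le f g)) -big_split.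
by apply: eq_bigr => u _; rewrite mcoeffD mulrDl scalerDl.
Qed.

HB.instance Definition _ :=
  GRing.isSemilinear.Build K oreLaurent (endL K) *:%R eps_at eps_at_semilinear.

Lemma eps_atT a u : eps_at (ore_term a u) = (a * t u) *: (theta u : endL K).
Proof. by rewrite (eps_atw msuppU_le) big_seq_fset1 mcoeffUU. Qed.

End Eval.

Lemma cocycle0 gamma (t : cocycle_ext gamma) : t 0 = 1.
Proof.
by apply: (mulfI (cocycle_neq0 t 0)); rewrite mulr1 -{2}[t 0]theta0 -cocycleD addr0.
Qed.

Lemma eps_at1 gamma (t : cocycle_ext gamma) : eps_at t 1 = \1%VF.
Proof.
rewrite [LHS]eps_atT cocycle0 mulr1 scale1r; apply/lfunP=> x.
by rewrite id_lfunE theta0.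
Qed.

Lemma eps_atM gamma (t : cocycle_ext gamma) f g :
  eps_at t (f * g) = (eps_at t f \o eps_at t g)%VF.
Proof.
have sumE (I : Type) (r : seq I) (G : I -> oreLaurent) x :
    (eps_at t (\sum_(i <- r) G i) : 'End(K)) x
    = \sum_(i <- r) (eps_at t (G i) : 'End(K)) x.
  by rewrite linear_sum /=; elim/big_rec2: _ => [|i y1 y2 _ <-];
     rewrite ?zero_lfunE ?add_lfunE.
apply/lfunP=> x; rewrite comp_lfunE.
have -> : f * g = ore_mul f g by [].
rewrite (oreE f) ore_mul_suml !sumE; apply: eq_bigr => u _.
rewrite (oreE g) ore_mul_sumr !sumE linear_sum; apply: eq_bigr => v _.
rewrite ore_mulT !eps_atT !endL_scaleE /= endL_scaleE cocycleD thetaD !thetaM.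
by rewrite !mulrA [_ * t u]mulrAC.
Qed.

Definition sumrank_space := {ffun latHom K e -> endL K}.

HB.instance Definition _ := Vector.copy sumrank_space {ffun latHom K e -> endL K}.

Section Code.
Variable tau : forall gamma : latHom K e, cocycle_ext gamma.

Definition eps f : sumrank_space := [ffun gamma => eps_at (tau gamma) f].

Lemma eps_semilinear : semilinear eps.
Proof.
by split=> [a f|f g]; apply/ffunP=> gamma; rewrite !ffunE ?linearZ ?linearD.
Qed.

HB.instance Definition _ :=
  GRing.isSemilinear.Build K oreLaurent sumrank_space *:%R eps eps_semilinear.

Fact LRM_subproof c :
  {C : {vspace sumrank_space} |
    forall w, w \in C <-> exists2 f, ore_le c f & w = eps f}.
Proof.
apply: submod_vspace => [|a _ _ [f fc ->] [g gc ->]].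
  by exists 0; [move=> u; rewrite msupp0|rewrite linear0].
exists (a *: f + g); last by rewrite linearP.
move=> u /(fsubsetP (msuppD_le _ _)); rewrite in_fsetU => /orP[|/gc//].
by move/(fsubsetP (msuppZ_le _ _))/fc.
Qed.

(* The subspace of the sum-rank space with underlying set eps (ore_le c). *)
Definition LRM (c : nat) : {vspace sumrank_space} := sval (LRM_subproof c).

Lemma LRMP c w : w \in LRM c <-> exists2 f, ore_le c f & w = eps f.
Proof. exact: svalP (LRM_subproof c) w. Qed.

End Code.

(* The F_q-rank of an endomorphism is the F_q-dimension of its image. *)
Definition sumrank_weight (w : sumrank_space) : nat :=
  (\sum_gamma \dim (limg (w gamma : 'End(K))))%N.

Definition is_min_distance (C : {vspace sumrank_space}) (d : nat) : Prop :=
  (exists w, [/\ w \in C, w != 0 & sumrank_weight w = d]) /\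
  (forall w, w \in C -> w != 0 -> (d <= sumrank_weight w)%N).

End OreLaurent.

(* Main.v *)
(* Put n = q - 1 and Lambda = n L, of index r n^m in Z^m. On each factor of the sum-rank
   space, X^u depends up to a scalar only on u mod Lambda, and the operators eps(X^u), for u
   running over Z^m / Lambda, are K-linearly independent: the automorphisms theta^u separate
   the classes mod L, and the characters gamma separate L / Lambda.

   The weight of eps(f) is at least the K-dimension of eps(A f), A being the Ore
   ring, since the endomorphisms psi \o phi, with phi fixed, form a K-space of
   dimension rank(phi). This dimension is bounded below by counting leading
   monomials: order N^m by a positive linear form that is injective on the exponents
   of f, let a be the largest exponent of f, and represent every class mod Lambda by
   its smallest element d. The multiples X^(d - a) f with d >= a have leading
   exponents d, hence are independent. As the class of alpha in [0, n)^m only has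
   representatives d >= alpha, at least r prod_i (n - a_i) >= r n^(m-1) (n - c) of
   them are available. *)
Require Import Defs.
From mathcomp Require Import all_boot all_order all_fingroup all_algebra.
From mathcomp Require Import all_solvable all_field.
From mathcomp Require Import finmap monalg boolp ring zify.

Set Implicit Arguments.
Unset Strict Implicit.
Unset Printing Implicit Defensive.

Import Order.TTheory GRing.Theory Num.Theory.
Import FalgLfun.
Local Open Scope ring_scope.

(* Dedekind's argument: substituting s and subtracting chi i times the relation kills f i
   and multiplies G by a nonzero scalar. *)
Lemma eigen_separation (k : fieldType) (P : Type) (I : eqType) (t : seq I)
    (G : P -> k) (f : I -> P -> k) :
  (forall i, i \in t -> exists s : P -> P, exists chi : I -> k, exists chi0 : k,
     [/\ forall p, G (s p) = chi0 * G p,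
         forall j, j \in t -> forall p, f j (s p) = chi j * f j p
       & chi i != chi0]) ->
  (forall p, G p + \sum_(i <- t) f i p = 0) -> forall p, G p = 0.
Proof.
elim: t G f => [|v t IH] G f sep sum0 p.
  by have := sum0 p; rewrite big_nil addr0.
have [s [chi [chi0 [Gs fs chi_neq]]]] := sep v (mem_head v t).
have d0 : chi0 - chi v != 0 by rewrite subr_eq0 eq_sym.
apply: (mulfI d0); rewrite mulr0.
apply: (IH (fun p => (chi0 - chi v) * G p) (fun i p => (chi i - chi v) * f i p)).
  move=> i it; have it' : i \in v :: t by rewrite inE it orbT.
  have [s' [psi [psi0 [Gs' fs' psi_neq]]]] := sep i it'.
  exists s', psi, psi0; split=> // [p'|j jt p'].
    by rewrite Gs' mulrCA.
  by rewrite fs' ?inE ?jt ?orbT // mulrCA.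
move=> p' /=; under eq_bigr => i _ do rewrite mulrBl.
have sE : \sum_(j <- t) f j (s p') = \sum_(j <- t) chi j * f j p'.
  by apply: eq_big_seq => j jt; rewrite fs // inE jt orbT.
have := sum0 (s p'); have := sum0 p'.
rewrite !big_cons fs ?mem_head // Gs sE sumrB -mulr_sumr => E1 E2.
transitivity (chi0 * G p' + (chi v * f v p' + \sum_(j <- t) chi j * f j p')
  - chi v * (G p' + (f v p' + \sum_(j <- t) f j p'))); first by ring.
by rewrite E1 E2 mulr0 subr0.
Qed.

(** * Order of the Frobenius automorphism *)

Section FrobeniusOrder.
Context {F : finFieldType}.
Variable K : fieldExtType F.

Lemma FrobXE j x : (Frob K ^+ j) x = x ^+ (#|F| ^ j).
Proof.
elim: j x => [|j IH] x; first by rewrite expr0 id_lfunE.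
by rewrite exprSr lfun_mulE FrobE IH -exprM expnSr.
Qed.

Lemma card_finvect : #|finvect_type K| = (#|F| ^ \dim {:K})%N.
Proof.
have <- := card_vspacef (T := finvect_type K) (Vector.class (finvect_type K)).
exact: card_vspace.
Qed.

Lemma Frob_dim : Frob K ^+ \dim {:K} = 1.
Proof.
apply/lfunP=> x; rewrite FrobXE id_lfunE.
have := expf_card (x : finvect_type K).
by rewrite card_finvect.
Qed.

(** Fixed points of the [j]-th power are roots of [X^(q^j) - X], so there are at most [q^j < q^r] of
    them. *)
Lemma Frob_faithful j : (0 < j < \dim {:K})%N -> exists x, (Frob K ^+ j) x != x.
Proof.
case/andP=> j_gt0 j_lt.
have q_gt1 : (1 < #|F|)%N := finNzRing_gt1 F.
have qj : (1 < #|F| ^ j)%N by rewrite -(exp1n j) ltn_exp2r.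
pose E := finvect_type K.
have [x xP|all_fix] := pickP (fun x : E => (Frob K ^+ j) (x : K) != x).
  by exists x.
pose p : {poly E} := 'X^(#|F| ^ j) - 'X.
have size_p : size p = (#|F| ^ j).+1.
  by rewrite size_polyDl ?size_polyXn // size_polyN size_polyX ltnS.
have p0 : p != 0 by rewrite -size_poly_eq0 size_p.
have rootsE : all (root p) (enum E).
  apply/allP=> x _; rewrite /root !hornerE subr_eq0.
  by have := all_fix x; rewrite FrobXE => /negbFE.
have := max_poly_roots p0 rootsE (enum_uniq E).
by rewrite -cardE card_finvect size_p ltnS leq_exp2l // leqNgt j_lt.
Qed.

End FrobeniusOrder.

(** * The automorphisms [theta] modulo [L] *)

Section Theta.
Context {F : finFieldType} {K : fieldExtType F} {m : nat}.
Variable e : 'rV[int]_m.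
Implicit Types u v : 'rV[int]_m.

Lemma theta_lattice u x : in_lattice K e u -> theta K e u x = x.
Proof.
rewrite /in_lattice /theta => /dvdzP[k ->].
by rewrite mulrC -exprz_exp -exprnP Frob_dim exp1rz id_lfunE.
Qed.

Lemma theta_neq u v :
  ~~ in_lattice K e (v - u) -> exists x, theta K e v x != theta K e u x.
Proof.
rewrite /in_lattice; set d := dotz e _; set r := \dim _ => ndvd.
have r0 : r%:Z != 0 by rewrite eqz_nat -lt0n adim_gt0.
have [j jE] : exists j : nat, (d %% r)%Z = j.
  by exists `|(d %% r)%Z|%N; rewrite gez0_abs ?modz_ge0.
have jP : (0 < j < r)%N.
  rewrite lt0n -ltz_nat -jE ltz_pmod ?ltz_nat ?adim_gt0 // andbT.
  by apply: contraNneq ndvd => j0; apply/dvdz_mod0P; rewrite jE j0.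
have [x xP] := Frob_faithful jP.
exists x; rewrite -[v](subrK u) addrC thetaD.
apply: contraNneq xP => E.
have : theta K e (- u) (theta K e u (theta K e (v - u) x)) = x.
  by rewrite E -thetaD addNr theta0.
rewrite -thetaD addNr theta0 /theta -/d (divz_eq d r) jE.
rewrite FrobzD mulrC -exprz_exp -exprnP Frob_dim exp1rz id_lfunE.
by move/eqP.
Qed.

End Theta.

(** * Characters of [L] and the sublattice Lambda *)

Section Characters.
Context {F : finFieldType} {K : fieldExtType F} {m : nat} {e : 'rV[int]_m}.

Definition unit_expz (w : {unit F}) (k : int) : {unit F} :=
  FinRing.unit F (unitrXz k (valP w)).

Lemma unit_expzD w k l : unit_expz w (k + l) = (unit_expz w k * unit_expz w l)%g.
Proof. by apply: val_inj; rewrite /= exprzDr ?(valP w). Qed.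

Lemma unit_expz_eq1 w k : unit_expz w k = 1%g -> (#[w]%g %| k)%Z.
Proof.
have H (j : nat) : (val w) ^+ j = 1 -> (#[w]%g %| j%:Z)%Z.
  move=> E; rewrite dvdzE /= order_dvdn; apply/eqP/val_inj.
  by rewrite FinRing.val_unitX E.
move/(congr1 val); case: k => j /=; first exact: H.
move=> /(congr1 GRing.inv); rewrite invr1 /exprz invrK => /H.
by rewrite !dvdzE.
Qed.

Fact latHom_mul_subproof (g h : latHom K e) (u v : lattice K e) :
  (g (u + v) * h (u + v) = (g u * h u) * (g v * h v))%g.
Proof.
by rewrite !latHomD; apply: val_inj; rewrite /= mulrACA.
Qed.

Definition latHom_mul (g h : latHom K e) : latHom K e :=
  LatHom (latHom_mul_subproof g h).

(* Membership in Lambda = (q - 1) L: if u = (q - 1) w then e . u = (q - 1) (e . w). *)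
Definition periodic (u : 'rV[int]_m) : bool :=
  [forall i, (#|F|.-1 %| u ord0 i)%Z] &&
  ((#|F|.-1 * \dim {:K})%N %| dotz e u)%Z.

(** The coordinates and [(e . l) / r] are additive on [L]. Powers of a generator of the cyclic group
    of units turn each of them into a character, trivial at [l] only if the additive value is
    divisible by [q - 1]. *)
Lemma latHom_separate (l : lattice K e) :
  ~~ periodic (val l) -> exists g : latHom K e, g l != 1%g.
Proof.
have /cyclicP[w wE] := field_unit_group_cyclic [set: {unit F}]%G.
have ow : #[w]%g = #|F|.-1 by rewrite orderE -wE card_finField_unit.
have r0 : (\dim {:K})%:Z != 0 by rewrite eqz_nat -lt0n adim_gt0.
have hom (k : lattice K e -> int) : (forall u v, k (u + v) = k u + k v) ->
    ~~ (#|F|.-1 %| k l)%Z -> exists g : latHom K e, g l != 1%g.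
  move=> kD ndvd.
  have gD u v : unit_expz w (k (u + v))
      = (unit_expz w (k u) * unit_expz w (k v))%g.
    by rewrite kD unit_expzD.
  exists (LatHom gD); apply: contraNneq ndvd => /unit_expz_eq1.
  by rewrite ow.
rewrite negb_and => /orP[/forallPn[i]|ndvd].
  by apply: (hom (fun u => val u 0 i)) => u v; rewrite raddfD mxE.
apply: (hom (fun u => (dotz e (val u) %/ (\dim {:K})%:Z)%Z)) => [u v|].
  by rewrite raddfD dotzD divzDl //; exact: (valP u).
apply: contra ndvd; rewrite PoszM -{2}(divzK (valP l)).
by rewrite dvdz_mul2r.
Qed.

End Characters.

(** * Independence of the monomials acting on the sum-rank space *)

Section Independence.
Context {F : finFieldType} {K : fieldExtType F} {m : nat} {e : 'rV[int]_m}.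
Variable tau : forall gamma : latHom K e, cocycle_ext gamma.
Variables (I : eqType) (t : seq I) (g : I -> 'rV[int]_m) (c : I -> K).
Variables (u : 'rV[int]_m) (a : K).
Hypothesis sum0 : forall gamma x,
  a * tau gamma u * theta K e u x
  + \sum_(i <- t) c i * tau gamma (g i) * theta K e (g i) x = 0.

(** Replacing [x] by [z * x] multiplies a term by [theta (g i) z], which depends only on [g i]
    modulo [L], and a suitable [z] tells another class from that of [u]. Hence the class of [u]
    satisfies the relation alone. *)
Lemma lattice_class_sum0 gamma x :
  a * tau gamma u * theta K e u x
  + \sum_(i <- t | in_lattice K e (g i - u))
      c i * tau gamma (g i) * theta K e (g i) x = 0.
Proof.
pose term i y := c i * tau gamma (g i) * theta K e (g i) y.
pose t' := [seq i <- t | ~~ in_lattice K e (g i - u)].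
apply: (eigen_separation (t := t') (f := term)
  (G := fun y => a * tau gamma u * theta K e u y
  + \sum_(i <- t | in_lattice K e (g i - u)) term i y)) => [i|y]; last first.
  rewrite -[RHS](sum0 gamma y) -addrA; congr (_ + _).
  by rewrite big_filter [RHS](bigID (fun i => in_lattice K e (g i - u))) /=.
rewrite mem_filter => /andP[/theta_neq[z zP] _].
exists (fun y => z * y), (fun j => theta K e (g j) z), (theta K e u z).
split=> // [y|j _ y]; last by rewrite /term thetaM; ring.
rewrite thetaM mulrDr mulr_sumr; congr (_ + _); first by ring.
apply: eq_bigr => j jL; rewrite /term thetaM.
have -> : theta K e (g j) z = theta K e u z.
  by rewrite -{1}[g j](subrK u) thetaD theta_lattice.
by ring.
Qed.

(** At [x = 1], the cocycle condition lets one divide by [tau gamma u], leaving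
    [a + \sum_i c i * gamma (g i - u) = 0] over the class of [u] modulo [L]. Multiplying [gamma] by
    a fixed character then separates each term from the constant [a]. *)
Lemma aperiodic_coef0 :
  (forall i, i \in t -> ~~ periodic (K := K) (e := e) (g i - u)) -> a = 0.
Proof.
move=> aper.
(* The default 0 off [L] keeps [chi v] multiplicative in the character. *)
pose chi (v : 'rV[int]_m) (gamma : latHom K e) : K :=
  if insub v : option (lattice K e) is Some l then (val (gamma l))%:A else 0.
have chiM v g1 g2 : chi v (latHom_mul g1 g2) = chi v g1 * chi v g2.
  rewrite /chi; case: insubP => [l _ _|_]; last by rewrite mulr0.
  by rewrite /= -scalerAl mul1r scalerA.
pose t' := [seq i <- t | in_lattice K e (g i - u)].
have [gamma0 _] : exists gamma : latHom K e, true.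
  by exists (LatHom (latHom_fun := fun=> 1%g) (fun _ _ => esym (mulg1 _))).
apply: (eigen_separation (t := t') (f := fun i gamma => c i * chi (g i - u) gamma)
  (G := fun=> a) _ _ gamma0) => [i|gamma].
  rewrite mem_filter => /andP[iL /aper]; rewrite -[g i - u]/(val (Sub _ iL : lattice K e)).
  move=> /latHom_separate[d dP].
  exists (latHom_mul d), (fun j => chi (g j - u) d), 1; split.
  - by move=> _; rewrite mul1r.
  - by move=> j _ p; rewrite chiM; ring.
  rewrite /chi insubT; apply: contraNneq dP => /eqP.
  rewrite -subr_eq0 -[X in _ - X]scale1r -scalerBl scaler_eq0 oner_eq0 orbF subr_eq0.
  by move=> /eqP E; apply/eqP/val_inj.
apply: (mulIf (cocycle_neq0 (tau gamma) u)); rewrite mul0r.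
rewrite -[RHS](lattice_class_sum0 gamma 1) theta1 mulr1.
rewrite mulrDl big_filter mulr_suml; congr (_ + _); apply: eq_bigr => i iL.
rewrite theta1 mulr1 -mulrA; congr (_ * _).
rewrite -{2}[g i](subrK u) cocycleD theta_lattice //; congr (_ * _).
rewrite /chi insubT; apply/esym.
exact: (cocycle_extends (tau gamma) (Sub _ iL)).
Qed.

End Independence.

(** * Lower bounds for the sum-rank weight *)

Section RankBound.
Context {F : finFieldType} {K : fieldExtType F} {m : nat} {e : 'rV[int]_m}.
Variable tau : forall gamma : latHom K e, cocycle_ext gamma.

(** The hypothesis on [lam] amounts to one linear equation for each [gamma] and each basis vector of
    the image of [phi gamma]. With more unknowns [lam i] than equations, a nonzero solution would
    exist. *)
Lemma card_le_sumrank_weight (I : finType) (b : I -> 'rV[int]_m)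
    (phi : sumrank_space K e) :
  (forall lam : I -> K,
     (forall gamma x, \sum_i lam i * tau gamma (b i)
                        * theta K e (b i) ((phi gamma : 'End(K)) x) = 0) ->
     forall i, lam i = 0) ->
  (#|I| <= sumrank_weight phi)%N.
Proof.
move=> indep.
pose J := {gamma : latHom K e & 'I_(\dim (limg (phi gamma : 'End(K))))}.
have cardJ : #|{: J}| = sumrank_weight phi.
  rewrite card_tagged sumnE big_map big_enum /=.
  by apply: eq_bigr => gamma _; rewrite card_ord.
rewrite -cardJ leqNgt; apply/negP=> ltJI.
pose B (j : J) : K := (vbasis (limg (phi (tag j) : 'End(K))))`_(tagged j).
pose M : 'M[K]_(#|I|, #|{: J}|) := \matrix_(i, j)
  (tau (tag (enum_val j)) (b (enum_val i)) * theta K e (b (enum_val i)) (B (enum_val j))).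
have /rowV0Pn[v /sub_kermxP vM0 v_neq0] : kermx M != 0.
  rewrite kermx_eq0 -row_leq_rank -ltnNge.
  exact: leq_ltn_trans (rank_leq_col M) ltJI.
have vM j : \sum_i v 0 (enum_rank i) * tau (tag j) (b i) * theta K e (b i) (B j) = 0.
  have /rowP/(_ (enum_rank j)) := vM0; rewrite !mxE => E.
  rewrite -[RHS]E (reindex _ (onW_bij _ (enum_val_bij I))) /=.
  by apply: eq_bigr => i _; rewrite enum_valK mxE enum_rankK mulrA.
case/negP: v_neq0; apply/eqP/rowP=> i; rewrite mxE -[i]enum_valK.
apply: (indep (fun i => v 0 (enum_rank i))) => gamma x.
rewrite (coord_vbasis (memv_img (phi gamma : 'End(K)) (memvf x))).
under eq_bigr => k _ do rewrite linear_sum mulr_sumr.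
rewrite exchange_big big1 // => k _.
have /= vMk := vM (existT _ gamma k).
under eq_bigr => j _ do rewrite linearZ -scalerAr.
by rewrite -scaler_sumr [X in _ *: X]vMk scaler0.
Qed.

Lemma eps_atE (t : 'rV[int]_m -> K) (f : oreLaurent K m) x :
  (eps_at e t f : 'End(K)) x
  = \sum_(u <- msupp f) f@_u * t u * theta K e u x.
Proof.
rewrite /eps_at; elim/big_rec2: _ => [|u y1 y2 _ <-]; first by rewrite zero_lfunE.
by rewrite add_lfunE endL_scaleE.
Qed.

(* The leading monomials of the multiples X^(D s - a) f are the D s, which are pairwise
   distinct in Z^m / Lambda and cannot be cancelled there, being lighter than any other
   nonnegative vector of their class. *)
Lemma footprint_bound (f : oreLaurent K m) (a wt : 'rV[int]_m) (S : finType)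
    (D : S -> 'rV[int]_m) :
  a \in msupp f ->
  (forall (v : 'rV[int]_m) i, v \in msupp f -> 0 <= v 0 i) ->
  (forall v, v \in msupp f -> v != a -> dotz wt v < dotz wt a) ->
  (forall s i, a 0 i <= D s 0 i) ->
  (forall (s : S) (u : 'rV[int]_m), (forall i, 0 <= u 0 i) ->
     periodic (K := K) (e := e) (u - D s) -> dotz wt (D s) <= dotz wt u) ->
  (forall s s', periodic (K := K) (e := e) (D s - D s') -> s = s') ->
  (#|S| <= sumrank_weight (eps tau f))%N.
Proof.
move=> af f_ge0 a_max aD D_min D_inj.
apply: (card_le_sumrank_weight (b := fun s => D s - a)) => lam lam0 s1.
apply/eqP/negPn/negP => lam_s1.
(* Among the shifts with nonzero coefficient, [s0] has the heaviest leading monomial. The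
   contradiction is that its leading coefficient [co (s0, a)] vanishes. *)
have [s0 lam_s0 s0_max] := arg_maxP
  (fun s => dotz wt (D s - a)) (P := fun s => lam s != 0) lam_s1.
pose co (p : S * 'rV[int]_m) := lam p.1 * theta K e (D p.1 - a) f@_(p.2).
pose g (p : S * 'rV[int]_m) := D p.1 - a + p.2.
pose pairs := [seq (s, v) | s <- enum S, v <- msupp f].
have pairs_uniq : uniq pairs.
  by apply: allpairs_uniq; rewrite ?enum_uniq // => -[? ?] [? ?].
(* Terms with [lam] zero are dropped: the maximality of [s0] does not cover them. *)
pose t := [seq p <- pairs | (p != (s0, a)) && (lam p.1 != 0)].
suff : co (s0, a) = 0.
  apply/eqP; rewrite mulf_neq0 //=; apply/negP=> /eqP E.
  have : theta K e (- (D s0 - a)) (theta K e (D s0 - a) f@_a) = 0.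
    by rewrite E linear0.
  by rewrite -thetaD addNr theta0; apply/eqP; rewrite mcoeff_neq0.
apply: (aperiodic_coef0 (tau := tau) (t := t) (g := g) (c := co) (u := g (s0, a))).
  move=> gamma x.
  pose term p := co p * tau gamma (g p) * theta K e (g p) x.
  have inP : (s0, a) \in pairs by apply/allpairsP; exists (s0, a); rewrite mem_enum.
  rewrite -/(term (s0, a)) -[RHS](lam0 gamma x).
  transitivity (\sum_(p <- pairs) term p).
    rewrite [RHS](bigD1_seq (s0, a)) //=; congr (_ + _); rewrite big_filter.
    rewrite big_mkcondr; apply: eq_bigr => p _; case: eqP => //= E.
    by rewrite /term /co E !mul0r.
  rewrite big_allpairs big_enum /=; apply: eq_bigr => s _.
  rewrite ffunE eps_atE linear_sum mulr_sumr; apply: eq_bigr => v _.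
  rewrite /term /co /g /= cocycleD [theta K e (D s - a + v) x]thetaD !thetaM; ring.
move=> [s v]; rewrite mem_filter => /andP[/andP[neq lam_s]].
move=> /allpairsP[[s' v'] /= [_ vf [? ?]]]; subst s' v'.
(* Minimality of [D s0] and maximality of [s0] give [dotz wt a <= dotz wt v], which forces [v = a].
   Then [D s] and [D s0] are congruent, so [s = s0]. *)
apply/negP; rewrite /g /= subrK => per.
have nonneg i : 0 <= (D s - a + v) 0 i.
  by rewrite !mxE addr_ge0 ?f_ge0 // subr_ge0.
have le1 := D_min s0 _ nonneg per.
have le2 := s0_max s lam_s.
have va : v = a.
  apply/eqP/negPn/negP=> /(a_max v vf).
  move: le1 le2; rewrite dotzD !dotzB; lia.
by move: neq per; rewrite va subrK => neq /D_inj E; rewrite E eqxx in neq.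
Qed.

End RankBound.

(** * Representatives of the classes modulo Lambda *)

Lemma dvdz_sub_small (d a b : nat) :
  (a < d)%N -> (b < d)%N -> (d %| a%:Z - b%:Z)%Z -> a = b.
Proof.
move=> ad bd; rewrite -eqz_mod_dvd !modz_nat eqz_nat !modn_small //.
by move/eqP.
Qed.

Section Representatives.
Context {F : finFieldType} {K : fieldExtType F} {m : nat} {e : 'rV[int]_m}.
Implicit Types u v : 'rV[int]_m.
Local Notation n := #|F|.-1.
Local Notation r := (\dim {:K}).
Local Notation cell := ({ffun 'I_m -> 'I_n} * 'I_r)%type.
Local Notation per := (periodic (K := K) (e := e)).

Lemma periodicD u v : per u -> per v -> per (u + v).
Proof.
move=> /andP[/forallP un ur] /andP[/forallP vn vr]; apply/andP; split.
  by apply/forallP=> i; rewrite mxE rpredD.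
by rewrite dotzD rpredD.
Qed.

Lemma periodicN u : per u -> per (- u).
Proof.
move=> /andP[/forallP un ur]; apply/andP; split.
  by apply/forallP=> i; rewrite mxE rpredN.
by rewrite -sub0r dotzB dotz0 sub0r rpredN.
Qed.

Lemma dotzZ k u : dotz e (k *: u) = k * dotz e u.
Proof.
by rewrite mulr_sumr; apply: eq_bigr => i _; rewrite mxE mulrCA.
Qed.

Lemma gcdz_dotz : exists u, dotz e u = \big[gcdz/0]_(i < m) e 0 i.
Proof.
elim/big_ind: _ => [|_ _ [u <-] [v <-]|i _].
- by exists 0; rewrite dotz0.
- have [x [y <-]] := Bezoutz (dotz e u) (dotz e v).
  by exists (x *: u + y *: v); rewrite dotzD !dotzZ.
exists (delta_mx 0 i); rewrite /dotz (bigD1 i) //= mxE !eqxx mulr1 big1 ?addr0 //.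
by move=> j ji; rewrite mxE (negPf ji) andbF mulr0.
Qed.

(** A Bezout vector [x *: u] satisfies the congruence; reducing its coordinates modulo [r] makes
    them nonnegative and changes [dotz e] by a multiple of [r]. *)
Lemma gcdz_dotz_nonneg : gcdz (\big[gcdz/0]_(i < m) e 0 i) r%:Z = 1 ->
  exists2 u : 'rV[int]_m, forall i, 0 <= u 0 i & (r %| dotz e u - 1)%Z.
Proof.
have r0 : r%:Z != 0 by rewrite eqz_nat -lt0n adim_gt0.
have [u <-] := gcdz_dotz; have [x [y <-]] := Bezoutz (dotz e u) r%:Z => E.
exists (\row_i ((x * u ord0 i) %% r)%Z) => [i|]; first by rewrite mxE modz_ge0.
have -> : \row_i ((x * u ord0 i) %% r)%Z = x *: u - r%:Z *: \row_i ((x * u ord0 i) %/ r)%Z.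
  by apply/rowP=> i; rewrite !mxE /modz mulrC [_ * r%:Z]mulrC.
rewrite dotzB !dotzZ -E; set Q := dotz e (\row_i _).
have -> : x * dotz e u - r%:Z * Q - (x * dotz e u + y * r%:Z) = r%:Z * - (Q + y).
  by ring.
exact: dvdz_mulr.
Qed.

(** The weights of the nonnegative vectors congruent to [v] form a nonempty set of natural numbers,
    which has a minimum. *)
Lemma exists_minimal_representative (wt v : 'rV[int]_m) :
  (forall u, (forall i, 0 <= u 0 i) -> 0 <= dotz wt u) ->
  (forall i, 0 <= v 0 i) ->
  exists d : 'rV[int]_m, [/\ forall i, 0 <= d 0 i, per (d - v) &
    forall u, (forall i, 0 <= u 0 i) -> per (u - d) -> dotz wt d <= dotz wt u].
Proof.
move=> wt_ge0 v_ge0.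
pose Q k := `[< exists u : 'rV[int]_m,
  [/\ forall i, 0 <= u 0 i, per (u - v) & dotz wt u = k%:Z] >].
have exQ : exists k, Q k.
  exists `|dotz wt v|%N; apply/asboolP; exists v; split=> //.
    rewrite subrr; apply/andP; split; last by rewrite dotz0 dvdz0.
    by apply/forallP=> i; rewrite mxE dvdz0.
  by rewrite gez0_abs ?wt_ge0.
case: (ex_minnP exQ) => k /asboolP[d [d_ge0 dv wtd]] k_min.
exists d; split=> // u u_ge0 ud.
rewrite wtd -[dotz wt u]gez0_abs ?wt_ge0 // lez_nat; apply: k_min.
apply/asboolP; exists u; split=> //; last by rewrite gez0_abs ?wt_ge0.
by rewrite -(subrKA d) periodicD.
Qed.

(* Z^m / Lambda is represented by the vectors alpha + n s w with alpha in [0, n)^m and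
   0 <= s < r, where e . w = 1 mod r. *)
Lemma exists_representatives (wt : 'rV[int]_m) :
  gcdz (\big[gcdz/0]_(i < m) e 0 i) r%:Z = 1 ->
  (forall u, (forall i, 0 <= u 0 i) -> 0 <= dotz wt u) ->
  exists D : cell -> 'rV[int]_m,
  [/\ forall (s : cell) i, (s.1 i)%:Z <= D s 0 i,
      forall (s : cell) u, (forall i, 0 <= u 0 i) -> per (u - D s) ->
        dotz wt (D s) <= dotz wt u
    & forall s s', per (D s - D s') -> s = s'].
Proof.
move=> /gcdz_dotz_nonneg[w w_ge0 ew] wt_ge0.
pose rho (s : cell) : 'rV[int]_m :=
  \row_i (s.1 i)%:Z + (n * s.2)%N%:Z *: w.
have rho_ge0 s i : 0 <= rho s 0 i by rewrite !mxE addr_ge0 ?mulr_ge0.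
have /fin_all_exists[D DP] s := exists_minimal_representative wt_ge0 (rho_ge0 s).
exists D; split=> [s i|s|s s' per_ss'].
(* The coordinate [D s 0 i] is nonnegative and congruent modulo [n] to [s.1 i < n], hence at least
   [s.1 i]. *)
- have [/(_ i) d0 /andP[/forallP/(_ i) + _] _] := DP s.
  rewrite !mxE => /dvdzP[k kE].
  suff : (s.1 i)%:Z <= D s ord0 i by [].
  have {}d0 : 0 <= D s ord0 i := d0.
  have dE : D s ord0 i = (s.1 i)%:Z + n%:Z * (k + (s.2)%:Z * w ord0 i).
    by move: kE; rewrite PoszM => /eqP; rewrite subr_eq => /eqP->; ring.
  move: d0; rewrite dE; move: (k + _) (ltn_ord (s.1 i)) => z lt_n d0.
  have [z_ge0|z_lt0] := lerP 0 z; first by rewrite lerDl mulr_ge0.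
  have : n%:Z * (z + 1) <= 0 by rewrite mulr_ge0_le0 // -ltzD1 ltrD2r.
  by move: d0; rewrite mulrDr mulr1; lia.
- by have [] := DP s.
have {per_ss'} : per (rho s - rho s').
  have [_ p1 _] := DP s; have [_ p2 _] := DP s'.
  rewrite -(subrKA (D s)) periodicD //; first by rewrite -opprB periodicN.
  by rewrite -(subrKA (D s')) periodicD.
(* Coordinates modulo [n] recover the first component; [dotz e] modulo [n * r], with [e . w = 1]
   modulo [r], then recovers the second. *)
case: s s' => [al s] [al' s'] /andP[/forallP per1 per2].
have E : al = al'.
  apply/ffunP=> i; apply: val_inj => /=; move: (per1 i); rewrite !mxE /=.
  move=> per1_i; apply: (dvdz_sub_small (ltn_ord _) (ltn_ord _)).
  have -> : (al i)%:Z - (al' i)%:Z = (al i)%:Z + (n * s)%N%:Z * w ord0 i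
      - ((al' i)%:Z + (n * s')%N%:Z * w ord0 i)
      + n%:Z * ((s'%:Z - s%:Z) * w ord0 i) by rewrite !PoszM; ring.
  by rewrite rpredD ?dvdz_mulr.
congr (_, _) => //; apply: val_inj => /=.
move: per2; rewrite E.
have -> : rho (al', s) - rho (al', s') = (n%:Z * (s%:Z - s'%:Z)) *: w.
  by apply/rowP=> i; rewrite !mxE /= !PoszM; ring.
rewrite dotzZ PoszM -mulrA dvdz_mul2l; last first.
  by rewrite eqz_nat -lt0n -subn1 subn_gt0 finNzRing_gt1.
move=> per2.
apply: (dvdz_sub_small (ltn_ord _) (ltn_ord _)).
have -> : s%:Z - s'%:Z = (s%:Z - s'%:Z) * dotz e w - (s%:Z - s'%:Z) * (dotz e w - 1).
  by ring.
by rewrite rpredB // dvdz_mull.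
Qed.

End Representatives.

(** * Counting estimates and radix expansions *)

Lemma card_ord_geq n a : #|[pred j : 'I_n | (a <= j)%N]| = (n - a)%N.
Proof.
rewrite -sum1_card; have [na|an] := leqP n a.
  rewrite big1 => [|j]; first by apply/esym/eqP.
  by rewrite inE leqNgt (leq_trans (ltn_ord j) na).
rewrite (eq_bigl (fun j : 'I_n => (a <= j)%N)) // -(big_geq_mkord _ _ predT (fun=> 1%N)).
by rewrite sum_nat_const_nat muln1.
Qed.

(** The extra factor [n] avoids the exponent [size s - 1]. Induction rests on
    [n * (n - (a + A)) <= (n - a) * (n - A)], whose sides differ by [a * A] when nothing is
    truncated. *)
Lemma leq_prod_subn (I : Type) (s : seq I) (n : nat) (a : I -> nat) :
  (n ^ size s * (n - \sum_(i <- s) a i) <= n * \prod_(i <- s) (n - a i))%N.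
Proof.
elim: s => [|i s IH]; first by rewrite !big_nil subn0 mul1n muln1.
rewrite !big_cons /= expnS.
move: IH; set P := (\prod_(_ <- _) _)%N.
set A := (\sum_(_ <- _) _)%N; set N := (n ^ _)%N => IH.
apply: (@leq_trans (N * ((n - a i) * (n - A)))%N); last first.
  by rewrite mulnCA [leqRHS]mulnCA leq_mul2l IH orbT.
rewrite -mulnA [leqLHS]mulnCA leq_mul2l; apply/orP; right.
nia.
Qed.

Lemma radix_inj (B m : nat) (u v : 'I_m -> nat) :
  (forall i, u i < B)%N -> (forall i, v i < B)%N ->
  (\sum_(i < m) B ^ i * u i = \sum_(i < m) B ^ i * v i)%N -> u =1 v.
Proof.
elim: m u v => [|m IH] u v uB vB; first by move=> _ [].
rewrite !big_ord_recl !mul1n.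
have shift (w : 'I_m.+1 -> nat) : (\sum_(i < m) B ^ bump 0 i * w (lift ord0 i)
    = B * \sum_(i < m) B ^ i * w (lift ord0 i))%N.
  by rewrite big_distrr; apply: eq_bigr => i _; rewrite /= expnS mulnA.
rewrite !shift => E.
have B_gt0 : (0 < B)%N := leq_ltn_trans (leq0n _) (uB ord0).
have E0 : u ord0 = v ord0.
  have := congr1 (modn^~ B) E.
  by rewrite /= !(mulnC B) (addnC (u _)) (addnC (v _)) !modnMDl !modn_small.
move: E; rewrite E0 => /addnI/eqP; rewrite eqn_pmul2l // => /eqP/IH{}IH i.
case: (unliftP ord0 i) => [j ->|->] //.
exact: IH.
Qed.

(** * Dimension and minimum distance of the code *)

Section Code.
Context {F : finFieldType} {K : fieldExtType F} {m : nat} {e : 'rV[int]_m}.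
Variable tau : forall gamma : latHom K e, cocycle_ext gamma.
Variable c : nat.
Hypothesis e_gcd : gcdz (\big[gcdz/0]_(i < m) e 0 i) (\dim {:K})%:Z = 1.
Local Notation n := #|F|.-1.
Local Notation r := (\dim {:K}).

(** The exponents in a polynomial of degree at most [c] are digit strings in base [c + 1], and this
    form reads off the number that they write, so it separates them. *)
Let wt : 'rV[int]_m := \row_i (c.+1 ^ i)%N%:Z.

Lemma ore_le_ub (f : oreLaurent K m) u i :
  ore_le c f -> u \in msupp f -> u 0 i <= c%:Z.
Proof.
move=> fc /fc[u_ge0]; apply: le_trans.
by rewrite (bigD1 i) //= lerDl sumr_ge0.
Qed.

Lemma radix_wt_inj (u v : 'rV[int]_m) :
  (forall i, 0 <= u 0 i <= c%:Z) -> (forall i, 0 <= v 0 i <= c%:Z) ->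
  dotz wt u = dotz wt v -> u = v.
Proof.
have toN (w : 'rV[int]_m) : (forall i, 0 <= w 0 i <= c%:Z) ->
    dotz wt w = (\sum_(i < m) c.+1 ^ i * `|w ord0 i|)%N%:Z.
  move=> w_c; rewrite /dotz -natz natr_sum; apply: eq_bigr => i _.
  have /andP[w0 _] := w_c i.
  by rewrite mxE natz PoszM gez0_abs.
have small (w : 'rV[int]_m) (wc : forall i, 0 <= w 0 i <= c%:Z) i : (`|w ord0 i| < c.+1)%N.
  by have /andP[w0 w1] := wc i; rewrite ltnS -lez_nat gez0_abs.
move=> uc vc; rewrite !toN // => -[/radix_inj uv].
apply/rowP=> i; have /andP[u0 _] := uc i; have /andP[v0 _] := vc i.
by rewrite -[LHS]gez0_abs // uv ?gez0_abs //; apply: small.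
Qed.

Lemma sumrank_weight_ge (f : oreLaurent K m) :
  (0 < m)%N -> ore_le c f -> f != 0 ->
  (r * n ^ (m - 1) * (n - c) <= sumrank_weight (eps tau f))%N.
Proof.
move=> m_gt0 fc f0.
have wt_ge0 (u : 'rV[int]_m) : (forall i, 0 <= u 0 i) -> 0 <= dotz wt u.
  by move=> u0; apply: sumr_ge0 => i _; rewrite mxE mulr_ge0.
have f_ge0 (v : 'rV[int]_m) i : v \in msupp f -> 0 <= v 0 i by move=> /fc[].
have f_c (v : 'rV[int]_m) (vf : v \in msupp f) i : 0 <= v 0 i <= c%:Z.
  by rewrite f_ge0 ?(ore_le_ub _ fc).
have /fset0Pn[v0 v0f] : msupp f != fset0 
  by apply: contraNneq f0 => E; rewrite (oreE f) E big_seq_fset0.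
have [[a af] _ a_max] := arg_maxP
  (fun v : msupp f => dotz wt (val v)) (P := xpredT) (i0 := FSetSub v0f) isT.
have [D [D_ge D_min D_inj]] := exists_representatives (wt := wt) e_gcd wt_ge0.
(* For these cells [D s >= s.1 >= a] coordinatewise, as [footprint_bound] requires. *)
pose S : {set {ffun 'I_m -> 'I_n} * 'I_r} :=
  setX [set al in family (fun i => [pred j : 'I_n | (`|a ord0 i| <= j)%N])] setT.
have cardS : #|{: {s | s \in S}}| = (\prod_(i < m) (n - `|a ord0 i|) * r)%N.
  rewrite card_sig; transitivity #|S|; first exact: eq_card.
  rewrite cardsX cardsT card_ord cardsE.
  congr (_ * _)%N; rewrite card_family foldrE big_map big_enum /=.
  by apply: eq_bigr => i _; rewrite card_ord_geq.
apply: leq_trans (footprint_bound (wt := wt)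
  (D := fun s : {s | s \in S} => D (val s)) tau af f_ge0 _ _ _ _).
- rewrite cardS -mulnA [leqRHS]mulnC leq_mul2l; apply/orP; right.
  have n_gt0 : (0 < n)%N by rewrite -subn1 subn_gt0 finNzRing_gt1.
  (* Multiplying by [n] turns [n ^ (m - 1)] into [n ^ m], the form of [leq_prod_subn]. *)
  rewrite -(leq_pmul2l n_gt0) mulnA -expnS subn1 prednK //.
  have := leq_prod_subn (enum 'I_m) n (fun i => `|a ord0 i|%N).
  rewrite size_enum_ord !big_enum /=; apply: leq_trans.
  rewrite leq_mul2l leq_sub2l ?orbT //.
  have [_] := fc a af; rewrite -lez_nat; apply: le_trans.
  rewrite -natz natr_sum ler_sum // => i _.
  by rewrite natz gez0_abs ?f_ge0.
- move=> v vf va; have le_va : dotz wt v <= dotz wt a := a_max (FSetSub vf) isT.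
  rewrite lt_neqAle; apply/andP; split=> //; apply: contraNneq va => E.
  by rewrite (radix_wt_inj (f_c v vf) (f_c a af) E).
- move=> [s sS] i; apply: le_trans (D_ge s i).
  move: sS; rewrite inE => /andP[+ _]; rewrite inE => /familyP/(_ i).
  by rewrite inE -lez_nat gez0_abs ?f_ge0.
- by move=> s u; apply: D_min.
- by move=> s s' /D_inj; apply: val_inj.
Qed.

Hypothesis m_gt0 : (0 < m)%N.
Hypothesis c_lt : (c < n)%N.

(** For [c < n] the weight bound is positive, while the zero word has weight 0. *)
Lemma eps_eq0 (f : oreLaurent K m) : ore_le c f -> eps tau f = 0 -> f = 0.
Proof.
move=> fc ef; apply/eqP/negPn/negP => f0.
have := sumrank_weight_ge m_gt0 fc f0; rewrite ef /sumrank_weight.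
rewrite big1 => [|gamma _]; last first.
  by rewrite ffunE lim0g dimv0.
rewrite leqNgt !muln_gt0 expn_gt0 adim_gt0 subn_gt0 c_lt.
by rewrite (leq_ltn_trans (leq0n c) c_lt).
Qed.

(** Total degree at most [c] bounds every exponent by [c], so the monomials are tuples over
    ['I_c.+1]; there are ['C(m + c, m)] of them. *)
Let T := [set t : m.-tuple 'I_c.+1 | \sum_(i <- t) i <= c]%N.
Let expo (t : m.-tuple 'I_c.+1) : 'rV[int]_m := \row_i (tnth t i : nat)%:Z.

Let expo_inj : injective expo.
Proof.
move=> t t' /rowP E; apply: eq_from_tnth => i; apply: val_inj.
by have := E i; rewrite !mxE => -[].
Qed.

Let expo_sum t : \sum_i expo t 0 i = (\sum_(i <- t) i)%N%:Z.
Proof.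
rewrite big_tuple -natz natr_sum; apply: eq_bigr => i _.
by rewrite mxE natz.
Qed.

Let expo_surj (f : oreLaurent K m) u :
  ore_le c f -> u \in msupp f -> exists2 t, t \in T & u = expo t.
Proof.
move=> fc uf; have [u0 u_sum] := fc u uf.
pose t := [tuple inord `|u ord0 i|%N : 'I_c.+1 | i < m].
have uE : u = expo t.
  apply/rowP=> i; rewrite mxE tnth_mktuple inordK ?gez0_abs ?u0 //.
  by rewrite ltnS -lez_nat gez0_abs ?(ore_le_ub _ fc) ?u0.
by exists t => //; rewrite inE -lez_nat -expo_sum -uE.
Qed.

(** The images of the monomials indexed by [T] span the code, and they are free by [eps_eq0]. *)
Lemma dim_LRM : \dim (LRM tau c) = 'C(c + m, c).
Proof.
rewrite -bin_sub ?leq_addr // addKn addnC -card_partial_ord_partitions -/T.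
pose b (i : 'I_#|T|) := expo (enum_val i).
have b_inj : injective b by move=> i j /expo_inj/enum_val_inj.
pose X := [tuple eps tau (ore_term (1 : K) (b i)) | i < #|T|].
have Xi (i : 'I_#|T|) : X`_i = eps tau (ore_term 1 (b i)).
  by rewrite -tnth_nth tnth_mktuple.
have epsZ (k : K) u : k *: eps tau (ore_term 1 u) = eps tau (ore_term k u).
  rewrite -linearZ; congr eps; apply/malgP=> v.
  by rewrite mcoeffZ !mcoeffU mulrnAr mulr1.
pose comb (k : 'I_#|T| -> K) : oreLaurent K m := \sum_i ore_term (k i) (b i).
have comb_coef k i : (comb k)@_(b i) = k i.
  rewrite /comb raddf_sum (bigD1 i) //= mcoeffUU big1 ?addr0 // => j ji.
  by rewrite mcoeffU (inj_eq b_inj) (negPf ji).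
have comb_le k : ore_le c (comb k).
  move=> u; rewrite -mcoeff_neq0 raddf_sum => /eqP.
  case: (pickP (fun i => b i == u)) => [i /eqP <- _|no_i []].
    split=> [j|]; first by rewrite mxE.
    by rewrite expo_sum lez_nat; have := enum_valP i; rewrite inE.
  by rewrite big1 // => i _; rewrite /= mcoeffU no_i.
have combE k : \sum_(i < #|T|) k i *: X`_i = eps tau (comb k).
  by rewrite linear_sum; apply: eq_bigr => i _; rewrite Xi epsZ.
have freeX : free X.
  apply/freeP=> k; rewrite combE => /(eps_eq0 (comb_le k)) E i.
  by rewrite -comb_coef E mcoeff0.
suff -> : LRM tau c = <<X>>%VS by move/eqP: freeX; rewrite size_tuple.
apply/eqP; rewrite eqEsubv; apply/andP; split.
  apply/subvP=> w /LRMP[f fc ->]; rewrite (oreE f) linear_sum big_seq.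
  apply: rpred_sum => u /(expo_surj fc)[t tT ->].
  rewrite /= -epsZ rpredZ // -(enum_rankK_in tT tT) -Xi.
  by rewrite memv_span // mem_nth // size_tuple.
apply/span_subvP=> w /tnthP[i ->]; rewrite tnth_mktuple.
apply/LRMP; exists (comb (fun j => (j == i)%:R)) => //.
rewrite /comb (bigD1 i) //= eqxx big1 ?addr0 // => j /negPf->.
exact: ore_term0.
Qed.

End Code.

Theorem theorem3p3 (F : finFieldType) (K : fieldExtType F) (m : nat)
    (e : 'rV[int]_m) (tau : forall gamma : latHom K e, cocycle_ext gamma)
    (c : nat) :
  (1 <= m)%N ->
  gcdz (\big[gcdz/0]_(i < m) e 0 i) (\dim {:K})%:Z = 1 ->
  (1 <= c <= #|F| - 2)%N ->
  \dim (LRM tau c) = 'C(c + m, c) /\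
  exists2 d : nat, is_min_distance (LRM tau c) d
    & (\dim {:K} * (#|F| - 1) ^ (m - 1) * (#|F| - 1 - c) <= d)%N.
Proof.
move=> m_gt0 e_gcd c_bounds.
have c_lt : (c < #|F|.-1)%N by move: c_bounds; lia.
have dimC := dim_LRM tau e_gcd m_gt0 c_lt.
split=> //.
(* The minimum distance is the least weight of a nonzero codeword; such codewords exist because the
   dimension is a positive binomial coefficient. *)
pose Q d := `[< exists2 w, w \in LRM tau c & (w != 0) && (sumrank_weight w == d) >].
have exQ : exists d, Q d.
  exists (sumrank_weight (vpick (LRM tau c))); apply/asboolP.
  exists (vpick (LRM tau c)); first exact: memv_pick.
  by rewrite eqxx andbT vpick0 -dimv_eq0 dimC -lt0n bin_gt0 leq_addr.
case: (ex_minnP exQ) => d /asboolP[w wC /andP[w0 /eqP wd]] d_min.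
exists d.
  split; first by exists w.
  move=> w' w'C w'0; apply: d_min; apply/asboolP.
  by exists w'; rewrite // w'0 eqxx.
have [f fc wf] : exists2 f, ore_le c f & w = eps tau f by apply/LRMP.
rewrite !(subn1 #|F|) -wd wf; apply: sumrank_weight_ge => //.
by apply: contraNneq w0 => f0; rewrite wf f0 linear0.
Qed.
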